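(* Let $n$ be a positive integer, let $\sigma,\pi,\rho\in S_n$ and let $1\le i\leq n-1$ be such that $\sigma=\pi\rho$ and $R(\sigma s_i)=R(\sigma)$. Then there exists a unique factorization $\sigma s_i=\pi'\rho'$ (that is, a unique pair $(\pi',\rho')\in S_n\times S_n$ with $\sigma s_i=\pi'\rho'$) such that either (1) $\pi=\pi'$, $\rho^{-1}\rho'\in S$ and $R(\rho)=R(\rho')$; or (2) $\rho=\rho'$, $\pi^{-1}\pi'\in S$ and $R(\pi)=R(\pi')$.
   Context: $S_n$ is the symmetric group on $\{1,\ldots,n\}$; a permutation $\sigma$ is written in linear notation $\sigma_1\sigma_2\ldots\sigma_n$ with $\sigma_i=\sigma(i)$, and products are compositions, $(\pi\rho)(i)=\pi(\rho(i))$. $s_i=(i\ i+1)$ is the simple transposition and $S=\{s_1,\ldots,s_{n-1}\}$. A permutation $\sigma$ has a recoil at $i\in\{1,\ldots,n-1\}$ if $\sigma^{-1}(i)>\sigma^{-1}(i+1)$, i.e. $i+1$ appears before $i$ in the word $\sigma_1\ldots\sigma_n$. $R(\sigma)\subset\{1,\ldots,n-1\}$ is the set of recoils of $\sigma$. *)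

(* Defs.v *)
From mathcomp Require Import all_boot all_fingroup.

Set Implicit Arguments.
Unset Strict Implicit.
Unset Printing Implicit Defensive.

Local Open Scope group_scope.

(* Letters and positions 1..n are the elements 0..n-1 of 'I_n, and the indices
   1..n-1 of simple transpositions and recoils are the elements 0..n-2 of
   'I_n.-1; all of them are shifted down by one. *)

Definition lo_ord (n : nat) (i : 'I_n.-1) : 'I_n := widen_ord (leq_pred n) i.

Lemma hi_ord_subproof (n : nat) (i : 'I_n.-1) : (i.+1 < n)%N.
Proof. by rewrite -ltn_predRL. Qed.

Definition hi_ord (n : nat) (i : 'I_n.-1) : 'I_n :=
  Ordinal (hi_ord_subproof i).

(* The library's product [p * q] applies [p] first; [p \oP q] applies [q]
   first. *)
Definition comp_perm (n : nat) (p q : 'S_n) : 'S_n := q * p.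

Notation "p \oP q" := (comp_perm p q) (at level 40, left associativity) :
  group_scope.

Lemma comp_permE (n : nat) (p q : 'S_n) (x : 'I_n) : (p \oP q) x = p (q x).
Proof. by rewrite permM. Qed.

Definition simple_tperm (n : nat) (i : 'I_n.-1) : 'S_n :=
  tperm (lo_ord i) (hi_ord i).

Definition simple_tperms (n : nat) : {set 'S_n} :=
  [set simple_tperm i | i : 'I_n.-1].

Definition recoils (n : nat) (s : 'S_n) : {set 'I_n.-1} :=
  [set i : 'I_n.-1 | (s^-1 (hi_ord i) < s^-1 (lo_ord i))%N].

(* Main.v *)
(* The permutation sigma s_i is obtained from sigma by exchanging two adjacent
   letters a and b, which only affects the relative order of the pair {a, b}:
   the recoils are unchanged unless |a - b| = 1, that is, unless the reflection
   sigma s_i sigma^-1 is simple. A factorization of type (1) must be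
   (pi, rho s_i), which works when t = rho s_i rho^-1 is not simple; one of
   type (2) must be (pi t, rho), which works when t is simple, because
   pi t pi^-1 = sigma s_i sigma^-1 is not simple by hypothesis. *)

Require Import Defs.
From mathcomp Require Import all_boot all_fingroup.
From mathcomp Require Import zify.

Local Open Scope group_scope.

(** Nothing lies strictly between [lo_ord i] and [hi_ord i], so swapping them reverses the order of
    no other pair. *)
Lemma simple_tperm_ltn (n : nat) (i : 'I_n.-1) (x y : 'I_n) :
  x != y -> tperm x y != simple_tperm i ->
  (simple_tperm i x < simple_tperm i y)%N = (x < y)%N.
Proof.
move=> neq_xy neq_t.
have not_lo_hi : ~~ ((x == lo_ord i) && (y == hi_ord i)).
  by apply: contra neq_t => /andP[/eqP-> /eqP->].
have not_hi_lo : ~~ ((x == hi_ord i) && (y == lo_ord i)).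
  by apply: contra neq_t => /andP[/eqP-> /eqP->]; rewrite tpermC.
rewrite !permE /=; move: neq_xy not_lo_hi not_hi_lo.
by rewrite -!val_eqE /=; do !case: ifP; rewrite /=; lia.
Qed.

(** In terms of [\oP], [simple_tperm i ^ p] is $p s_i p^{-1}$, the swap of the letters at positions
    $i$ and $i+1$ of [p]. *)
Lemma recoils_simple_tperm (n : nat) (p : 'S_n) (i : 'I_n.-1) :
  (recoils (p \oP simple_tperm i) == recoils p) =
  (simple_tperm i ^ p \notin simple_tperms n).
Proof.
have recoilE k : (k \in recoils (p \oP simple_tperm i)) =
    (simple_tperm i (p^-1 (hi_ord k)) < simple_tperm i (p^-1 (lo_ord k)))%N.
  by rewrite inE /comp_perm invMg {1 2}/simple_tperm tpermV !permM.
have lo_hi k : hi_ord k != lo_ord k :> 'I_n by rewrite -val_eqE /=; lia.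
apply/idP/idP => [/eqP eq_rec | not_simple].
  (* If the conjugate is $s_k$, then $s_i$ swaps the positions of $k$ and $k+1$, which flips the
     recoil at $k$. *)
  apply/imsetP => -[k _ conjE].
  have commE x : simple_tperm i (p^-1 x) = p^-1 (simple_tperm k x).
    by rewrite -conjE conjgE !permM permK.
  have /setP/(_ k) := eq_rec.
  rewrite recoilE inE !commE {1 2}/simple_tperm tpermL tpermR.
  have : p^-1 (hi_ord k) != p^-1 (lo_ord k) by rewrite (inj_eq perm_inj).
  by rewrite -val_eqE /=; lia.
apply/eqP/setP => k; rewrite recoilE inE.
apply: simple_tperm_ltn; first by rewrite (inj_eq perm_inj).
apply: contraNneq not_simple => <-.
by rewrite tpermJ !permKV tpermC; apply: imset_f.
Qed.

Theorem proposition3p3 (n : nat) (n_gt0 : (0 < n)%N)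
    (sigma pi rho : 'S_n) (i : 'I_n.-1)
    (sigmaE : sigma = pi \oP rho)
    (recoils_eq : recoils (sigma \oP simple_tperm i) = recoils sigma) :
  exists! f : 'S_n * 'S_n,
    sigma \oP simple_tperm i = f.1 \oP f.2 /\
    ((pi = f.1 /\ rho^-1 \oP f.2 \in simple_tperms n /\
        recoils rho = recoils f.2) \/
     (rho = f.2 /\ pi^-1 \oP f.1 \in simple_tperms n /\
        recoils pi = recoils f.1)).
Proof.
have sigma_conj : simple_tperm i ^ sigma \notin simple_tperms n.
  by rewrite -recoils_simple_tperm recoils_eq.
have type1 rho' : sigma \oP simple_tperm i = pi \oP rho' ->
    rho' = rho \oP simple_tperm i.
  by rewrite sigmaE /comp_perm mulgA => /mulIg <-.
have type2 pi' : sigma \oP simple_tperm i = pi' \oP rho ->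
    pi' = pi \oP (simple_tperm i ^ rho).
  rewrite sigmaE /comp_perm => eq_prod.
  by rewrite conjgE -!mulgA eq_prod mulKg.
have [simple_t | not_simple_t] :=
  boolP (simple_tperm i ^ rho \in simple_tperms n).
- exists (pi \oP (simple_tperm i ^ rho), rho); split=> /=.
    split; first by rewrite sigmaE /comp_perm conjgE !mulgA mulgV mul1g.
    right; split=> //; split; first by rewrite /comp_perm mulgK.
    have [k _ tE] := imsetP simple_t.
    (* Conjugating by [rho] and then by [pi] is conjugating by [sigma]. *)
    apply/esym/eqP; rewrite tE recoils_simple_tperm -tE -conjgM.
    by rewrite sigmaE in sigma_conj.
  case=> pi' rho' /= [prodE [[eq_pi [_ eq_rec]] | [eq_rho _]]]; subst.
    move/eqP: eq_rec; rewrite (type1 _ prodE) eq_sym recoils_simple_tperm.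
    by rewrite simple_t.
  by rewrite (type2 _ prodE).
- exists (pi, rho \oP simple_tperm i); split=> /=.
    split; first by rewrite sigmaE /comp_perm !mulgA.
    left; split=> //; split; first by rewrite /comp_perm mulgK imset_f.
    by apply/esym/eqP; rewrite recoils_simple_tperm.
  case=> pi' rho' /= [prodE [[eq_pi _] | [eq_rho [simple_t _]]]]; subst.
    by rewrite (type1 _ prodE).
  (* In type (2), $\pi^{-1}\pi'$ is forced to be [simple_tperm i ^ rho]. *)
  move: simple_t; rewrite (type2 _ prodE) /comp_perm mulgK.
  by rewrite (negPf not_simple_t).
Qed.
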